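(* Let $n\ge 1$ be an integer and let $\lambda_0,\lambda_1,\lambda_2\in\mathbb{C}$ be such that all the zeros of $u(z)=\lambda_0+\binom{n}{1}\lambda_1 z+\binom{n}{2}\lambda_2 z^2$ lie in the half plane $\{z\in\mathbb{C}: |z|\le |z-\tfrac n2|\}$. Let $B$ be the associated operator on polynomials of degree at most $n$, $B[P(z)]=\lambda_0P(z)+\lambda_1\left(\frac{nz}{2}\right)\frac{P'(z)}{1!}+\lambda_2\left(\frac{nz}{2}\right)^2\frac{P''(z)}{2!}$. If $P(z)$ is a polynomial of degree $n$ with complex coefficients, then for all real or complex numbers $\alpha,\beta$ with $|\alpha|\le 1$, $|\beta|\le 1$, every real $R\ge 1$ and every $z\in\mathbb{C}$ with $|z|\ge 1$, $$\left|B[P(Rz)]-\alpha B[P(z)]+\beta\left\{\left(\frac{R+1}{2}\right)^n-|\alpha|\right\}B[P(z)]\right|\le \left|(R^n-\alpha)+\beta\left\{\left(\frac{R+1}{2}\right)^n-|\alpha|\right\}\right|\,|B[z^n]|\,\max_{|w|=1}|P(w)|.$$ Equality holds for $P(z)=\lambda z^n$, $\lambda\ne 0$.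
   Context: $B$ is applied to polynomials in the variable $z$: $B[P(Rz)]$ denotes the result of applying $B$ to the polynomial $z\mapsto P(Rz)$, evaluated at $z$ (so derivatives are taken with respect to $z$), and $B[z^n]$ denotes $B$ applied to the monomial $z^n$, evaluated at $z$. The integer $n$ in the definition of $B$ is the same $n$ as the degree of $P$. *)

(* Defs.v *)
From mathcomp Require Import all_boot all_order all_algebra.
From mathcomp Require Import complex.
From mathcomp Require Import boolp classical_sets functions reals.
From mathcomp Require Import topology normedtype derive realfun.
Import Order.TTheory GRing.Theory Num.Theory.
Import numFieldNormedType.Exports.

Set Implicit Arguments.
Unset Strict Implicit.
Unset Printing Implicit Defensive.

Local Open Scope classical_set_scope.
Local Open Scope ring_scope.
Local Open Scope complex_scope.

Definition upoly (R : realType) (n : nat) (l0 l1 l2 : R[i]) : {poly R[i]} :=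
  l0%:P + ('C(n, 1)%:R * l1) *: 'X + ('C(n, 2)%:R * l2) *: 'X^2.

Definition Bop (R : realType) (n : nat) (l0 l1 l2 : R[i])
    (P : {poly R[i]}) : {poly R[i]} :=
  l0 *: P
  + l1 *: ((n%:R / 2) *: 'X) * (1`!%:R^-1 *: P^`())
  + l2 *: ((n%:R / 2) *: 'X) ^+ 2 * (2`!%:R^-1 *: P^`(2)).

Definition dilate (R : realType) (r : R) (P : {poly R[i]}) : {poly R[i]} :=
  P \Po (r%:C *: 'X).

(* The modulus of a complex number is again an element of R[i], hence the Re.
   The supremum is attained, see maxmod_attained. *)
Definition maxmod (R : realType) (P : {poly R[i]}) : R :=
  sup [set complex.Re `|P.[w]| | w in [set w : R[i] | `|w| = 1]].

Section MaxmodIsMax.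
Variable R : realType.
Implicit Types (P : {poly R[i]}) (w : R[i]).

Let circ (s x : R) : R[i] := x +i* (s * Num.sqrt (1 - x ^+ 2)).

Let ReM (a b : R[i]) :
  complex.Re (a * b)
  = complex.Re a * complex.Re b - complex.Im a * complex.Im b.
Proof. by case: a b => [? ?] [? ?]. Qed.

Let ImM (a b : R[i]) :
  complex.Im (a * b)
  = complex.Re a * complex.Im b + complex.Im a * complex.Re b.
Proof. by case: a b => [? ?] [? ?]. Qed.

Let circ_continuous (s : R) : continuous (fun x => complex.Im (circ s x)).
Proof.
rewrite /circ /= => x.
apply: (@continuousM R R (fun=> s) (fun x => Num.sqrt (1 - x ^+ 2))).
  exact: cst_continuous.
apply: (@continuous_comp _ _ _ (fun x : R => 1 - x ^+ 2) Num.sqrt).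
  apply: continuousB; first exact: cst_continuous.
  exact: exprn_continuous.
exact: sqrt_continuous.
Qed.

Let horner_circ_continuous (s : R) P :
  continuous (fun x => complex.Re P.[circ s x]) /\
  continuous (fun x => complex.Im P.[circ s x]).
Proof.
elim/poly_ind: P => [|P c [cR cI]].
  by split=> x; under eq_fun do rewrite horner0; exact: cst_continuous.
have cIc := @circ_continuous s.
split=> x; under eq_fun do rewrite hornerMXaddC raddfD /= ?ReM ?ImM /=.
- apply: cvgD; last exact: cvg_cst.
  apply: cvgB; apply: cvgM; [exact: cR|exact: cvg_id|exact: cI|exact: cIc].
- apply: cvgD; last exact: cvg_cst.
  apply: cvgD; apply: cvgM; [exact: cR|exact: cIc|exact: cI|exact: cvg_id].
Qed.

Let modP_continuous (s : R) P :
  continuous (fun x => complex.Re `|P.[circ s x]|).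
Proof.
have [cR cI] := horner_circ_continuous s P.
move=> x; under eq_fun do rewrite normc_def /= !expr2.
apply: (@continuous_comp _ _ _
  (fun x => complex.Re P.[circ s x] * complex.Re P.[circ s x]
          + complex.Im P.[circ s x] * complex.Im P.[circ s x]) Num.sqrt); last exact: sqrt_continuous.
by apply: cvgD; apply: cvgM; [exact: cR|exact: cR|exact: cI|exact: cI].
Qed.

Let norm1P w : `|w| = 1 -> complex.Re w ^+ 2 + complex.Im w ^+ 2 = 1.
Proof.
by move=> w1; apply/complexI; rewrite complex.add_Re2_Im2 w1 expr1n.
Qed.

Let circ_norm (s x : R) : s ^+ 2 = 1 -> x \in `[-1, 1] -> `|circ s x| = 1.
Proof.
move=> s1; rewrite in_itv /= => x1.
have x21 : x ^+ 2 <= 1 by rewrite -real_normK ?num_real// expr_le1// ler_norml.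
rewrite normc_def /= exprMn s1 mul1r sqr_sqrtr ?subr_ge0//.
by rewrite addrC subrK sqrtr1.
Qed.

Let circ_surj w : `|w| = 1 ->
  complex.Re w \in `[-1, 1] /\
  (w = circ 1 (complex.Re w) \/ w = circ (-1) (complex.Re w)).
Proof.
case: w => x y /norm1P /= xy1; split.
  rewrite in_itv /= -ler_norml -(@expr_le1 _ 2)// real_normK ?num_real//.
  by rewrite -xy1 lerDl sqr_ge0.
have e : Num.sqrt (1 - x ^+ 2) = `|y|.
  by rewrite -xy1 [_ + y ^+ 2]addrC addrK sqrtr_sqr.
rewrite /circ /= e mul1r mulN1r.
by have [y0|y0] := ger0P y; [left|right; rewrite opprK].
Qed.

Let maxmod_ex P : exists2 w0 : R[i], `|w0| = 1 &
  forall w, `|w| = 1 -> complex.Re `|P.[w]| <= complex.Re `|P.[w0]|.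
Proof.
have half s : exists2 c, c \in `[-1, 1] & forall t, t \in `[-1, 1] ->
    complex.Re `|P.[circ s t]| <= complex.Re `|P.[circ s c]|.
  apply: (@EVT_max R (fun x => complex.Re `|P.[circ s x]|)).
    by rewrite (le_trans (y := 0)) ?lerN10.
  by apply: continuous_subspaceT; exact: modP_continuous.
have [c c1 cM] := half 1; have [d d1 dM] := half (-1).
have nc : `|circ 1 c| = 1 by apply: circ_norm => //; rewrite expr1n.
have nd : `|circ (-1) d| = 1 by apply: circ_norm => //; rewrite sqrrN expr1n.
have [le|/ltW le] := leP (complex.Re `|P.[circ 1 c]|)
                         (complex.Re `|P.[circ (-1) d]|).
- exists (circ (-1) d) => // w /circ_surj[w1 [->|->]]; last exact: dM.
  by apply: le_trans le; exact: cM.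
- exists (circ 1 c) => // w /circ_surj[w1 [->|->]]; first exact: cM.
  by apply: le_trans le; exact: dM.
Qed.

Let normRe (a : R[i]) : (complex.Re `|a|)%:C = `|a|.
Proof. by rewrite normc_def. Qed.

Lemma maxmod_attained P : exists2 w0 : R[i], `|w0| = 1 &
  `|P.[w0]| = (maxmod P)%:C.
Proof.
have [w0 w01 w0M] := maxmod_ex P; exists w0 => //.
rewrite -normRe; congr _%:C; apply/eqP; rewrite eq_le; apply/andP; split.
  apply: ub_le_sup; last by exists w0.
  by exists (complex.Re `|P.[w0]|) => _ [w /= w1 <-]; exact: w0M.
apply: ge_sup; first by exists (complex.Re `|P.[w0]|), w0.
by move=> _ [w /= w1 <-]; exact: w0M.
Qed.

Lemma le_maxmod P w : `|w| = 1 -> `|P.[w]| <= (maxmod P)%:C.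
Proof.
move=> w1; have [w0 w01 w0M] := maxmod_ex P.
rewrite -normRe lecR; apply: ub_le_sup; last by exists w.
by exists (complex.Re `|P.[w0]|) => _ [v /= v1 <-]; exact: w0M.
Qed.

End MaxmodIsMax.

(* Main.v *)
Require Import Defs.
From mathcomp Require Import all_boot all_order all_algebra all_solvable all_field.
From mathcomp Require Import complex reals.
From mathcomp Require Import ring lra.
Import Order.TTheory GRing.Theory Num.Theory.
Local Open Scope ring_scope.
Local Open Scope complex_scope.

(** Let z be fixed with |z| >= 1, put q = ((r+1)/2)^n, and let L be the linear
    functional that sends P to the value at z of
    B[P(r.)] - a B[P] + b (q - |a|) B[P]. The claim is |L P| <= |L X^n| M, with M
    the maximum of |P| on the unit circle. If it failed, c = L P / L X^n would
    have modulus larger than M. Because |P(w)| <= M |w|^n for |w| >= 1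
    ([growth_outside_disc]), F = P - c X^n then has degree n and all its zeros in
    the open unit disc, and L F = 0. So the theorem reduces
    ([comparison_principle]) to a statement about zeros: L F <> 0 whenever F has
    degree n and all its zeros lie in the open unit disc.

    Two facts give this. First, for r > 1 such an F satisfies
    |F(rw)| > q |F(w)| for |w| >= 1, factor by factor ([dilate_growth]), while the
    multiplier b (q - |a|) - a has modulus at most q; so the polynomial
    F(r.) - a F + b (q - |a|) F also has degree n and all its zeros in the open
    disc ([dilate_comb_zeros]); for r = 1 it is a multiple of F, and the comparison
    is made for F |-> B[F](z) instead. Secondly, B[F](z) does not vanish either
    ([Bop_neq0]): B[F](z)/F(z) is the value of the symmetric multiaffine form
    attached to u at the points (n/2) z/(z - w), w running over the zeros of F.
    All of these lie in the open half plane Re > n/4, where u has no zero, and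
    Walsh's coincidence theorem forbids the value 0. In degree 2 that theorem
    has an elementary proof through variances ([walsh_quadratic]).

    The growth estimate is obtained algebraically: Cauchy's estimate for the
    coefficients comes from averaging over roots of unity ([coef_le_circle]), and
    the factor n+1 that it costs is removed by passing to powers of P. *)

(** * Growth of polynomials outside the unit disc *)

Lemma prim_root_exists (C : numClosedFieldType) (N : nat) :
  (0 < N)%N -> exists w : C, N.-primitive_root w.
Proof.
move=> N_gt0; pose p : {poly C} := 'X^N - 1.
have [r Dp] := closed_field_poly_normal p.
rewrite (monicP _) ?monicXnsubC // scale1r in Dp.
have rN : all N.-unity_root r by apply/allP=> z; rewrite -root_prod_XsubC -Dp.
have sz_r : (N < (size r).+1)%N.
  by rewrite -(size_prod_XsubC r id) -Dp size_XnsubC.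
have [|w] := hasP (has_prim_root N_gt0 rN _ sz_r); last by exists w.
by rewrite -separable_prod_XsubC -Dp separable_Xn_sub_1 // pnatr_eq0 -lt0n.
Qed.

Lemma norm_prim_root (C : numClosedFieldType) (N : nat) (w : C) :
  N.-primitive_root w -> `|w| = 1.
Proof.
move=> wP; apply/eqP; rewrite -(@pexpr_eq1 _ _ N) //.
  by rewrite -normrX (prim_expr_order wP) normr1.
exact: prim_order_gt0 wP.
Qed.

Lemma sum_prim_root (C : numClosedFieldType) (N m : nat) (w : C) :
  N.-primitive_root w -> ~~ (N %| m)%N -> \sum_(i < N) (w ^+ m) ^+ i = 0.
Proof.
move=> wP Nm.
have w1 : w ^+ m - 1 != 0 by rewrite subr_eq0 -(prim_order_dvd wP).
apply: (mulfI w1); rewrite mulr0 -subrX1 -exprM mulnC exprM (prim_expr_order wP).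
by rewrite expr1n subrr.
Qed.

(** Cauchy's estimate without integration: the j-th coefficient is the average
    of w^-j P(w) over the N-th roots of unity w, as soon as N exceeds the
    degree. *)
Lemma coef_le_circle (C : numClosedFieldType) (P : {poly C}) (K : C) :
  (forall w : C, `|w| = 1 -> `|P.[w]| <= K) -> forall j, `|P`_j| <= K.
Proof.
move=> PK j.
have [Pj|jP] := leqP (size P) j.
  by rewrite nth_default // normr0 (le_trans (normr_ge0 P.[1])) // PK ?normr1.
pose N := size P; have N_gt0 : (0 < N)%N by apply: leq_ltn_trans jP.
have [w wP] := prim_root_exists C N N_gt0.
have w1 := norm_prim_root _ _ _ wP.
have wN m : `|w ^+ m| = 1 by rewrite normrX w1 expr1n.
(* N - j stands for the exponent -j, since w^N = 1. *)
have E : \sum_(i < N) (w ^+ i) ^+ (N - j) * P.[w ^+ i] = N%:R * P`_j.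
  transitivity (\sum_(k < N) P`_k * \sum_(i < N) (w ^+ (N - j + k)) ^+ i).
    transitivity (\sum_(i < N) \sum_(k < N) P`_k * (w ^+ (N - j + k)) ^+ i).
      apply: eq_bigr => i _; rewrite horner_coef mulr_sumr.
      apply: eq_bigr => k _; rewrite mulrCA -exprD; congr (_ * _).
      by rewrite -!exprM mulnC.
    by rewrite exchange_big; apply: eq_bigr => k _; rewrite mulr_sumr.
  rewrite (bigD1 (Ordinal jP)) //= [X in _ + X]big1 ?addr0.
    rewrite subnK ?(ltnW jP) // (prim_expr_order wP).
    under eq_bigr do rewrite expr1n.
    by rewrite sumr_const card_ord mulrC.
  move=> k /eqP kj; rewrite sum_prim_root ?mulr0 //.
  apply/negP => D; apply: kj; apply/val_inj => /=.
  have /eqP : (j = k %[mod N])%N.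
    have := D; rewrite /dvdn => /eqP D0.
    have := modnDml (N - j + k) j N; rewrite D0 add0n => ->.
    by rewrite addnAC subnK ?(ltnW jP) // modnDl.
  by rewrite !modn_small // => /eqP.
have NK : `|N%:R * P`_j| <= N%:R * K.
  rewrite -E (le_trans (ler_norm_sum _ _ _)) // -[N in N%:R]card_ord.
  rewrite mulr_natl -sumr_const; apply: ler_sum => i _.
  by rewrite normrM normrX wN expr1n mul1r PK.
by move: NK; rewrite normrM normr_nat ler_pM2l // ltr0n.
Qed.

Lemma horner_le_circle (C : numClosedFieldType) (P : {poly C}) (K z : C) (n : nat) :
  (size P <= n.+1)%N -> (forall w : C, `|w| = 1 -> `|P.[w]| <= K) ->
  1 <= `|z| -> `|P.[z]| <= n.+1%:R * (K * `|z| ^+ n).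
Proof.
move=> sP PK z1; rewrite (@horner_coef_wide _ n.+1) //.
apply: le_trans (ler_norm_sum _ _ _) _.
rewrite -[X in X%:R]card_ord mulr_natl -sumr_const; apply: ler_sum => i _.
rewrite normrM normrX ler_pM ?exprn_ge0 ?normr_ge0 ?coef_le_circle //.
by rewrite ler_weXn2l // -ltnS.
Qed.

Lemma bernoulli (R : numDomainType) (e : R) (k : nat) :
  0 <= e -> 1 + k%:R * e <= (1 + e) ^+ k.
Proof.
move=> e0; elim: k => [|k IH]; first by rewrite mul0r addr0 expr0.
have e1 : 0 <= 1 + e by rewrite addr_ge0.
rewrite exprS; apply: le_trans (ler_wpM2l e1 IH).
rewrite -subr_ge0.
have -> : (1 + e) * (1 + k%:R * e) - (1 + k.+1%:R * e) = k%:R * (e * e).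
  by rewrite -natr1; ring.
by rewrite mulr_ge0 ?ler0n // mulr_ge0.
Qed.

(** A linear factor cannot compensate for a geometric one: by Bernoulli's
    inequality at the exponent 2j, a ratio 1 + e > 1 would make j e^2 bounded. *)
Lemma le_of_exprn_le (R : archiRealFieldType) (n : nat) (x y : R) :
  0 <= x -> 0 <= y ->
  (forall k, x ^+ k <= (n * k).+1%:R * y ^+ k) -> x <= y.
Proof.
move=> x0 y0 H; rewrite leNgt; apply/negP => yx.
have y_gt0 : 0 < y.
  rewrite lt_neqAle y0 andbT eq_sym; apply/negP => /eqP y00.
  by have := H 1%N; rewrite y00 !expr1 mulr0 leNgt -y00 yx.
pose e := x / y - 1.
have e_gt0 : 0 < e by rewrite subr_gt0 ltr_pdivlMr // mul1r.
have q k : (1 + e) ^+ k <= (n * k).+1%:R.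
  by rewrite /e addrC subrK exprMn exprVn ler_pdivrMr ?exprn_gt0.
have [j jP] : exists j : nat, n.*2%:R / e ^+ 2 < j%:R.
  by exists (Num.bound (n.*2%:R / e ^+ 2)); rewrite archi_boundP ?divr_ge0 ?ler0n ?sqr_ge0.
move: jP; rewrite ltr_pdivrMr ?exprn_gt0 // => jP.
have j0 : 0 <= j%:R :> R by rewrite ler0n.
have : (1 + j%:R * e) ^+ 2 <= (1 + e) ^+ (2 * j).
  have e0 := ltW e_gt0; have e1 : 0 <= 1 + e by rewrite addr_ge0.
  have je : 0 <= 1 + j%:R * e by rewrite addr_ge0 ?mulr_ge0.
  by rewrite mulnC exprM lerXn2r ?nnegrE ?exprn_ge0 ?bernoulli.
move=> /le_trans /(_ (q _)).
rewrite mulnA muln2 -natr1 natrM => A.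
have ej : 0 <= j%:R * e by rewrite mulr_ge0 // ltW.
have := ler_wpM2l j0 (ltW jP) => B.
have j1 : j%:R != 0 :> R.
  apply/eqP => jz; move: jP; rewrite jz mul0r ltNge ler0n //.
have jp : 0 < j%:R :> R by rewrite lt_neqAle eq_sym j1.
have : j%:R * n.*2%:R < j%:R * (j%:R * e ^+ 2) by rewrite ltr_pM2l.
nra.
Qed.

Lemma normcR (R : rcfType) (x : R[i]) : `|x| = (complex.Re `|x|)%:C.
Proof. by rewrite normc_def. Qed.

Lemma Re_norm_ge0 (R : rcfType) (x : R[i]) : 0 <= complex.Re `|x|.
Proof. by rewrite -ler0c -normcR normr_ge0. Qed.

(** The crude bound (n+1) K |z|^n is applied to all powers of P: the factor
    becomes nk+1 and disappears under k-th roots. This replaces the maximum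
    principle for z^n P(1/z). *)
Lemma growth_outside_disc (R : realType) (P : {poly R[i]}) (K z : R[i]) (n : nat) :
  (size P <= n.+1)%N -> (forall w : R[i], `|w| = 1 -> `|P.[w]| <= K) ->
  1 <= `|z| -> `|P.[z]| <= K * `|z| ^+ n.
Proof.
move=> sP PK z1.
have K0 : 0 <= K by apply: le_trans (PK 1 _); rewrite ?normr_ge0 ?normr1.
have KR : K = (complex.Re K)%:C by rewrite RRe_real // ger0_real.
have K0' : 0 <= complex.Re K by rewrite -ler0c -KR.
rewrite normcR [`|z|]normcR KR -rmorphXn -rmorphM lecR.
apply: (@le_of_exprn_le _ n); rewrite ?mulr_ge0 ?exprn_ge0 ?Re_norm_ge0 //.
move=> k; rewrite -lecR rmorphXn /= -normcR rmorphM rmorph_nat rmorphXn rmorphM /=.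
rewrite rmorphXn /= -normcR -KR exprMn -exprM -normrX -horner_exp.
apply: horner_le_circle => //.
  apply: (leq_trans (size_poly_exp_leq _ _)); rewrite ltnS leq_mul2r.
  by apply/orP; right; case: (size P) sP.
by move=> w w1; rewrite horner_exp normrX lerXn2r ?nnegrE ?PK.
Qed.

(** * The comparison principle *)

(** If |L P| exceeded M |L X^n|, the quotient c = L P / L X^n would have modulus
    larger than M, so that P - c X^n would have degree n and, by
    [growth_outside_disc], all its zeros in the open unit disc, although L
    vanishes at it. *)
Lemma comparison_principle (R : realType) (n : nat) (L : {poly R[i]} -> R[i]) :
  scalar L ->
  (forall F : {poly R[i]}, size F = n.+1 ->
     (forall w, 1 <= `|w| -> F.[w] != 0) -> L F != 0) ->
  forall (P : {poly R[i]}) (M : R[i]), (size P <= n.+1)%N ->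
    (forall w : R[i], `|w| = 1 -> `|P.[w]| <= M) ->
    `|L P| <= `|L 'X^n| * M.
Proof.
move=> linL LF P M sP PM.
have LX : L 'X^n != 0.
  apply: LF; first by rewrite size_polyXn.
  move=> w w1; rewrite hornerXn expf_neq0 // -normr_gt0.
  exact: lt_le_trans w1.
have M0 : 0 <= M by apply: le_trans (PM 1 _); rewrite ?normr_ge0 ?normr1.
rewrite real_leNgt ?normr_real ?realM ?normr_real ?ger0_real //.
apply/negP => lt; pose c := L P / L 'X^n.
have cM : M < `|c|.
  by rewrite /c normrM normfV ltr_pdivlMr ?normr_gt0 // mulrC.
have : L (- c *: 'X^n + P) != 0; last first.
  by rewrite linL /c mulNr divfK // addNr eqxx.
apply: LF.
  have lead : (- c *: 'X^n + P)`_n != 0.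
    rewrite coefD coefZ coefXn eqxx mulr1 addrC subr_eq0.
    apply: contraTneq cM => <-.
    by rewrite -real_leNgt ?ger0_real ?normr_ge0 ?coef_le_circle.
  apply/eqP; rewrite eqn_leq; apply/andP; split.
    rewrite (leq_trans (size_polyD _ _)) // geq_max sP andbT.
    by rewrite (leq_trans (size_scale_leq _ _)) // size_polyXn.
  by rewrite ltnNge; apply: contra lead => /leq_sizeP ->.
move=> w w1; rewrite !hornerE mulNr addrC subr_eq0.
have wn : 0 < `|w| ^+ n by rewrite exprn_gt0 // (lt_le_trans _ w1).
have : `|P.[w]| < `|c * w ^+ n|.
  apply: le_lt_trans (growth_outside_disc _ P M w n sP PM w1) _.
  by rewrite normrM normrX ltr_pM2r.
by apply: contraTneq => ->; rewrite ltxx.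
Qed.

(** * Walsh's coincidence theorem for quadratic polynomials *)

Lemma ReD (R : rcfType) (x y : R[i]) :
  complex.Re (x + y) = complex.Re x + complex.Re y.
Proof. by case: x y => [? ?] [? ?]. Qed.

Lemma ReB (R : rcfType) (x y : R[i]) :
  complex.Re (x - y) = complex.Re x - complex.Re y.
Proof. by case: x y => [? ?] [? ?]. Qed.

Lemma ReMl (R : rcfType) (k : R) (x : R[i]) :
  complex.Re (k%:C * x) = k * complex.Re x.
Proof. by case: x => a b /=; rewrite mul0r subr0. Qed.

Lemma Re_sum (R : rcfType) (I : Type) (s : seq I) (F : I -> R[i]) :
  complex.Re (\sum_(i <- s) F i) = \sum_(i <- s) complex.Re (F i).
Proof. by apply: (big_morph _ (@ReD R)). Qed.

Lemma le_Re (R : rcfType) (x y : R[i]) : x <= y -> complex.Re x <= complex.Re y.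
Proof. by rewrite lecE => /andP[]. Qed.

(** Twice the square of the real part of a square root of s: a gauge whose
    sublevel sets are the regions bounded by parabolas with focus 0. *)
Definition parabolic_gauge (R : rcfType) (s : R[i]) : R :=
  complex.Re `|s| + complex.Re s.

Lemma parabolic_gauge_sum (R : rcfType) (I : Type) (s : seq I) (F : I -> R[i]) :
  parabolic_gauge R (\sum_(i <- s) F i) <= \sum_(i <- s) parabolic_gauge R (F i).
Proof.
rewrite /parabolic_gauge big_split -!Re_sum lerD2r.
apply: le_Re; exact: ler_norm_sum.
Qed.

Lemma parabolic_gaugeMl (R : rcfType) (k : R) (s : R[i]) :
  0 <= k -> parabolic_gauge R (k%:C * s) = k * parabolic_gauge R s.
Proof.
move=> k0; rewrite /parabolic_gauge normrM ger0_norm ?ler0c // !ReMl.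
by rewrite mulrDr.
Qed.

Lemma parabolic_gauge_sqr (R : rcfType) (d : R[i]) :
  parabolic_gauge R (d ^+ 2) = 2 * complex.Re d ^+ 2.
Proof.
rewrite /parabolic_gauge normrX -add_Re2_Im2.
by case: d => a b /=; rewrite !expr2 /=; ring.
Qed.

(** |XY| is also the modulus of X times the conjugate of Y, which dominates its
    real part; added to Re (XY), the products of imaginary parts cancel. *)
Lemma parabolic_gauge_mul (R : rcfType) (X Y : R[i]) :
  2 * (complex.Re X * complex.Re Y) <= parabolic_gauge R (X * Y).
Proof.
rewrite /parabolic_gauge normrM -(normcJ Y) -normrM.
have := le_Re _ _ _ (normc_ge_Re (X * Y^*)).
case: X Y => [a b] [c d] /= H.
have := le_trans (ler_norm _) H => {}H; lra.
Qed.

Lemma sumr_const_seq (V : nmodType) (I : Type) (s : seq I) (a : V) :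
  \sum_(i <- s) a = a *+ size s.
Proof. by rewrite big_const_seq count_predT iter_addr_0. Qed.

Lemma sum_sqr_le (R : realDomainType) (s : seq R) :
  (forall x, x \in s -> 0 < x) ->
  0 <= \sum_(x <- s) x /\ \sum_(x <- s) x ^+ 2 <= (\sum_(x <- s) x) ^+ 2.
Proof.
elim: s => [|x s IH] xs; first by rewrite !big_nil expr0n.
have [|s0 s2] := IH; first by move=> y ys; apply: xs; rewrite inE ys orbT.
have x0 : 0 < x by apply: xs; rewrite inE eqxx.
rewrite !big_cons; split; first by rewrite addr_ge0 // ltW.
by have := mulr_ge0 (ltW x0) s0; nra.
Qed.

Lemma sum_sqr_lt (R : realDomainType) (s : seq R) :
  (1 < size s)%N -> (forall x, x \in s -> 0 < x) ->
  \sum_(x <- s) x ^+ 2 < (\sum_(x <- s) x) ^+ 2.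
Proof.
case: s => [|x [|y s]] // _ xs.
have x0 : 0 < x by apply: xs; rewrite inE eqxx.
have y0 : 0 < y by apply: xs; rewrite !inE eqxx orbT.
have [|s0 s2] := @sum_sqr_le _ s.
  by move=> w ws; apply: xs; rewrite !inE ws !orbT.
rewrite !big_cons; set S := \sum_(_ <- _) _ in s2 *; set T := \sum_(_ <- _) _ in s0 s2 *.
have : 0 < x * y by rewrite mulr_gt0.
have : 0 <= x * T by rewrite mulr_ge0 // ltW.
have : 0 <= y * T by rewrite mulr_ge0 // ltW.
nra.
Qed.

(** Among deviations a_i > -h of zero sum, the sum of squares is extremal when
    all but one of them equal -h. *)
Lemma sum_sqr_dev_lt (R : realFieldType) (s : seq R) (c m : R) :
  (1 < size s)%N -> (forall x, x \in s -> c < x) ->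
  \sum_(x <- s) x = (size s)%:R * m ->
  \sum_(x <- s) (x - m) ^+ 2 < (size s)%:R * ((size s)%:R - 1) * (m - c) ^+ 2.
Proof.
move=> s1 cs sm; have := @sum_sqr_lt _ [seq x - c | x <- s].
rewrite size_map => /(_ s1) H.
have {H} : \sum_(x <- s) (x - c) ^+ 2 < (\sum_(x <- s) (x - c)) ^+ 2.
  by move: H; rewrite !big_map; apply => _ /mapP[x /cs cx ->]; rewrite subr_gt0.
have -> : \sum_(x <- s) (x - c) = (size s)%:R * (m - c).
  by rewrite sumrB sm sumr_const_seq mulrBr !mulr_natl.
have -> : \sum_(x <- s) (x - m) ^+ 2
   = \sum_(x <- s) (x - c) ^+ 2 - (size s)%:R * (m - c) ^+ 2.
  transitivity (\sum_(x <- s) ((x - c) ^+ 2 - 2 * (m - c) * x + (m ^+ 2 - c ^+ 2))).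
    by apply: eq_bigr => x _; ring.
  rewrite big_split sumrB /= -mulr_sumr sm sumr_const_seq.
  by rewrite -(mulr_natl (_ - _)); ring.
by move=> H; nra.
Qed.

(** The degree 2 case of Walsh's coincidence theorem for a half plane. With m the
    mean of the t_i, the symmetrized value is u(m) - l2/2 S, where S is the sum
    of the (t_i - m)^2. If it vanished, S would be n(n-1) times the product of
    the two numbers m - root of u, whose real parts are at least h = Re m - c;
    so the gauge of S would be at least 2 n(n-1) h^2. But it is at most twice the
    sum of the (Re (t_i - m))^2, which by [sum_sqr_dev_lt] is smaller. *)
Lemma walsh_quadratic (R : rcfType) (c : R) (l0 l1 l2 : R[i]) (ts : seq R[i]) :
  (0 < size ts)%N -> (forall t, t \in ts -> c < complex.Re t) ->
  (forall x, l0 + (size ts)%:R * l1 * x + 'C(size ts, 2)%:R * l2 * x ^+ 2 = 0 ->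
     complex.Re x <= c) ->
  l0 + l1 * \sum_(t <- ts) t
  + l2 * (((\sum_(t <- ts) t) ^+ 2 - \sum_(t <- ts) t ^+ 2) / 2) != 0.
Proof.
set n := size ts => n0 ct roots.
have nC0 : n%:R != 0 :> R[i] by rewrite pnatr_eq0 -lt0n.
pose m := (\sum_(t <- ts) t) / n%:R.
have T1 : \sum_(t <- ts) t = n%:R * m by rewrite mulrC divfK.
have Rm : \sum_(t <- ts) complex.Re t = n%:R * complex.Re m.
  by rewrite -Re_sum T1 -(rmorph_nat (real_complex R)) ReMl.
have cm : c < complex.Re m.
  rewrite -(@ltr_pM2l _ n%:R) ?ltr0n // -Rm mulr_natl.
  have -> : c *+ n = \sum_(t <- ts) c.
    by rewrite sumr_const_seq.
  rewrite big_seq [ltRHS]big_seq; apply: ltr_sum => //.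
  move: n0; rewrite /n; case: (ts) => //= t s _.
  by rewrite inE eqxx.
have C2 : 'C(n, 2)%:R * 2 = n%:R * (n%:R - 1) :> R[i].
  have := mul_bin_left n 1; rewrite bin1 => E.
  by rewrite -natrM mulnC E natrM natrB // mulrC.
pose S := \sum_(t <- ts) (t - m) ^+ 2.
have T2 : \sum_(t <- ts) t ^+ 2 = S + n%:R * m ^+ 2.
  transitivity (\sum_(t <- ts) ((t - m) ^+ 2 + 2 * m * t - m ^+ 2)).
    by apply: eq_bigr => t _; ring.
  rewrite sumrB big_split /= -mulr_sumr T1 sumr_const_seq.
  by rewrite -(mulr_natl (m ^+ 2)) -/n -/S; ring.
set E := (X in X != 0).
have EE : E = l0 + n%:R * l1 * m + 'C(n, 2)%:R * l2 * m ^+ 2 - l2 / 2 * S.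
  have -> : 'C(n, 2)%:R = n%:R * (n%:R - 1) / 2 :> R[i] by rewrite -C2 mulfK ?pnatr_eq0.
  by rewrite /E T1 T2; field.
apply/eqP => E0.
(* With a single point, or without a quadratic term, the value is u(m). *)
have [l2S|l2S] := eqVneq (l2 * S) 0.
  have um : complex.Re m <= c.
    by apply: roots; rewrite -E0 EE [l2 / 2 * S]mulrAC l2S mul0r subr0.
  by rewrite leNgt cm in um.
have l2N : l2 != 0 by apply: contraNneq l2S => ->; rewrite mul0r.
have n1 : (1 < n)%N.
  rewrite ltn_neqAle n0 andbT; apply: contraNneq l2S => n1.
  rewrite /S /m; move: n1; rewrite /n; case: (ts) => [|t [|]] //= _.
  by rewrite !big_seq1 divr1 subrr expr0n mulr0.
have CN : 'C(n, 2)%:R != 0 :> R[i] by rewrite pnatr_eq0 -lt0n bin_gt0.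
pose A := 'C(n, 2)%:R * l2; pose B := n%:R * l1.
have AN : A != 0 by rewrite mulf_neq0.
pose d := sqrtC (B ^+ 2 - 4 * A * l0).
have d2 : d ^+ 2 = B ^+ 2 - 4 * A * l0 by rewrite sqrtCK.
pose x := (- B + d) / (2 * A); pose y := (- B - d) / (2 * A).
have fact w : l0 + B * w + A * w ^+ 2 = A * ((w - x) * (w - y)).
  have -> : A * ((w - x) * (w - y)) = A * w ^+ 2 + B * w + (B ^+ 2 - d ^+ 2) / (4 * A).
    by rewrite /x /y; field.
  by rewrite d2; field.
have xc : complex.Re x <= c by apply: roots; rewrite fact subrr mul0r mulr0.
have yc : complex.Re y <= c by apply: roots; rewrite fact subrr !mulr0.
have SE : S = (n%:R * (n%:R - 1))%:C * ((m - x) * (m - y)).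
  rewrite rmorphM rmorphB rmorph1 !rmorph_nat /= -C2.
  have : l2 / 2 * S = A * ((m - x) * (m - y)).
    by rewrite -fact; apply/esym/eqP; rewrite -subr_eq0 -E0 EE.
  rewrite /A => H; apply: (mulfI l2N).
  transitivity (2 * (l2 / 2 * S)); first by field.
  by rewrite H; ring.
have N0 : 0 < n%:R * (n%:R - 1) :> R.
  by rewrite mulr_gt0 ?ltr0n // subr_gt0 ltr1n.
have low : n%:R * (n%:R - 1) * (2 * (complex.Re m - c) ^+ 2) <= parabolic_gauge R S.
  rewrite SE parabolic_gaugeMl ?(ltW N0) // ler_pM2l //.
  apply: le_trans (parabolic_gauge_mul _ _ _); rewrite ler_pM2l // !ReB.
  by rewrite expr2 ler_pM ?subr_ge0 ?(ltW cm) // lerD2l lerN2.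
have up : parabolic_gauge R S <= 2 * \sum_(t <- ts) (complex.Re t - complex.Re m) ^+ 2.
  apply: le_trans (parabolic_gauge_sum _ _ _ _) _; rewrite mulr_sumr.
  by apply: ler_sum => t _; rewrite parabolic_gauge_sqr ReB.
have := sum_sqr_dev_lt _ [seq complex.Re t | t <- ts] c (complex.Re m).
rewrite size_map !big_map -/n => /(_ n1) H.
have {}H : \sum_(t <- ts) (complex.Re t - complex.Re m) ^+ 2
    < n%:R * (n%:R - 1) * (complex.Re m - c) ^+ 2.
  by apply: H Rm => _ /mapP[t /ct ? ->].
have := le_trans low up; nra.
Qed.

(** * Zeros of the image under B *)

Lemma norm_le_shift (R : rcfType) (k : R) (x : R[i]) :
  0 < k -> (`|x| <= `|x - k%:C|) = (complex.Re x <= k / 2).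
Proof.
move=> k0; rewrite -(@ler_pXn2r _ 2) ?nnegrE ?normr_ge0 //.
rewrite -!add_Re2_Im2 lecR; case: x => a b /=; rewrite subr0 lerD2r.
by apply/idP/idP => H; nra.
Qed.

Lemma horner_prod_XsubC (C : comNzRingType) (ws : seq C) (z : C) :
  (\prod_(w <- ws) ('X - w%:P)).[z] = \prod_(w <- ws) (z - w).
Proof. by rewrite horner_prod; apply: eq_bigr => w _; rewrite !hornerE. Qed.

Lemma horner_deriv_prod (C : fieldType) (ws : seq C) (z : C) :
  (forall w, w \in ws -> z - w != 0) ->
  (\prod_(w <- ws) ('X - w%:P))^`().[z]
  = \prod_(w <- ws) (z - w) * \sum_(w <- ws) (z - w)^-1.
Proof.
elim: ws => [|w ws IH] zw; first by rewrite !big_nil derivC hornerE mulr0.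
have z0 : z - w != 0 by apply: zw; rewrite inE eqxx.
have zws v : v \in ws -> z - v != 0 by move=> vws; rewrite zw // inE vws orbT.
have {}IH := IH zws.
rewrite !big_cons derivM derivXsubC mul1r !hornerE IH horner_prod_XsubC.
by field.
Qed.

Lemma horner_deriv2_prod (C : fieldType) (ws : seq C) (z : C) :
  (forall w, w \in ws -> z - w != 0) ->
  (\prod_(w <- ws) ('X - w%:P))^`(2).[z]
  = \prod_(w <- ws) (z - w)
    * ((\sum_(w <- ws) (z - w)^-1) ^+ 2 - \sum_(w <- ws) (z - w)^-1 ^+ 2).
Proof.
elim: ws => [|w ws IH] zw.
  by rewrite !big_nil derivnC hornerE expr0n subrr mulr0.
have z0 : z - w != 0 by apply: zw; rewrite inE eqxx.
have zws v : v \in ws -> z - v != 0 by move=> vws; rewrite zw // inE vws orbT.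
have dM (p : {poly C}) : (('X - w%:P) * p)^`() = p + ('X - w%:P) * p^`().
  by rewrite derivM derivXsubC mul1r.
have d2 (p : {poly C}) : p^`(2) = p^`()^`() by [].
rewrite !big_cons d2 !dM derivD dM -d2 !hornerE.
by rewrite IH // horner_deriv_prod //=; field.
Qed.

Lemma horner_Bop (R : realType) (n : nat) (l0 l1 l2 : R[i]) (P : {poly R[i]}) (z : R[i]) :
  (Bop n l0 l1 l2 P).[z] = l0 * P.[z] + l1 * (n%:R / 2 * z) * P^`().[z]
    + l2 * (n%:R / 2 * z) ^+ 2 * (P^`(2).[z] / 2).
Proof.
rewrite /Bop (_ : 1`! = 1)%N // (_ : 2`! = 2)%N // !hornerE /=.
by field.
Qed.

Lemma horner_Bop_scalar (R : realType) (n : nat) (l0 l1 l2 z : R[i]) :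
  scalar (fun P => (Bop n l0 l1 l2 P).[z]).
Proof.
move=> a P Q; rewrite !horner_Bop !derivnD !derivnZ !derivD !derivZ !hornerE /=.
by field.
Qed.

Lemma poly_prod_roots (R : rcfType) (n : nat) (F : {poly R[i]}) :
  size F = n.+1 -> (forall w, 1 <= `|w| -> F.[w] != 0) ->
  exists a : R[i], exists ws : seq R[i],
    [/\ a != 0, size ws = n, F = a *: \prod_(w <- ws) ('X - w%:P)
      & forall w, w \in ws -> `|w| < 1].
Proof.
move=> sF zF; have [ws DF] := closed_field_poly_normal F.
have a0 : lead_coef F != 0 by rewrite lead_coef_eq0 -size_poly_eq0 sF.
exists (lead_coef F), ws; split=> //.
  by move: sF; rewrite DF size_scale // size_prod_XsubC => -[].
move=> w wws; rewrite real_ltNge ?normr_real ?realE ?ler01 //; apply/negP => /zF.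
by rewrite DF hornerE (rootP _) ?mulr0 ?eqxx // root_prod_XsubC.
Qed.

(** At a point where F does not vanish, B[F]/F is the symmetrization of u at the
    points t_w = (n/2) z/(z - w), w running over the zeros of F. Since
    |t_w - n/2| is (n/2)|w|/|z - w|, the condition |w| < |z| puts t_w in the half
    plane complementary to the one that contains the zeros of u. *)
Lemma Bop_neq0 (R : realType) (n : nat) (l0 l1 l2 : R[i]) (F : {poly R[i]}) (z : R[i]) :
  (1 <= n)%N ->
  (forall x, root (upoly n l0 l1 l2) x -> `|x| <= `|x - n%:R / 2|) ->
  size F = n.+1 -> (forall w, 1 <= `|w| -> F.[w] != 0) -> 1 <= `|z| ->
  (Bop n l0 l1 l2 F).[z] != 0.
Proof.
move=> n1 zu sF zF z1; have [a [ws [a0 sws DF ws1]]] := poly_prod_roots _ _ _ sF zF.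
pose k : R := n%:R / 2; have k0 : 0 < k by rewrite divr_gt0 ?ltr0n.
have kC : n%:R / 2 = k%:C by rewrite /k rmorphM fmorphV !rmorph_nat.
have zw w : w \in ws -> z - w != 0.
  move=> /ws1 w1; rewrite subr_eq0; apply: contraTneq z1 => ->.
  by rewrite -real_ltNge ?normr_real ?realE ?ler01.
pose t w := k%:C * z * (z - w)^-1.
have -> : (Bop n l0 l1 l2 F).[z] = F.[z] *
   (l0 + l1 * \sum_(x <- map t ws) x
    + l2 * (((\sum_(x <- map t ws) x) ^+ 2 - \sum_(x <- map t ws) x ^+ 2) / 2)).
  have -> : \sum_(x <- map t ws) x = k%:C * z * \sum_(w <- ws) (z - w)^-1.
    by rewrite big_map mulr_sumr.
  have -> : \sum_(x <- map t ws) x ^+ 2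
      = (k%:C * z) ^+ 2 * \sum_(w <- ws) (z - w)^-1 ^+ 2.
    by rewrite big_map mulr_sumr; apply: eq_bigr => w _; rewrite -exprMn.
  rewrite horner_Bop kC DF derivZ derivnZ !hornerZ horner_prod_XsubC.
  by rewrite horner_deriv_prod // horner_deriv2_prod //; field.
rewrite mulf_neq0 ?zF //; apply: (@walsh_quadratic _ (k / 2)).
- by rewrite size_map sws.
- move=> _ /mapP[w wws ->]; rewrite ltNge -norm_le_shift //.
  have tE : t w - k%:C = k%:C * w * (z - w)^-1.
    by rewrite /t; have := zw w wws => zw0; field.
  rewrite tE /t !normrM ler_pM2r ?normr_gt0 ?invr_eq0 ?zw //.
  rewrite ler_pM2l ?normr_gt0 ?gt_eqF ?ltcR //.
  apply/negP => zw1; have := lt_le_trans (ws1 w wws) (le_trans z1 zw1).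
  by rewrite ltxx.
- rewrite size_map sws => x ux; rewrite -norm_le_shift // -kC; apply: zu.
  by rewrite /root /upoly !hornerE bin1 /= -ux; apply/eqP; ring.
Qed.

(** * Zeros of the dilated combination *)

(** Both sides are distances from w, to rz and to z. The difference of the
    squares is (r - 1)/4 times
    (3r+1)|z|^2 - (r+3)|w|^2 + 2(r-1) Re (z conj w), and the last term is at least
    -(r-1)(|z|^2 + |w|^2), which leaves 2(r+1)(|z|^2 - |w|^2). *)
Lemma dilate_dist_lt (R : rcfType) (r : R) (z w : R[i]) :
  1 < r -> `|w| < `|z| -> ((r + 1) / 2)%:C * `|z - w| < `|r%:C * z - w|.
Proof.
move=> r1 wz.
have q0 : 0 <= (r + 1) / 2 by rewrite divr_ge0 ?ler0n ?addr_ge0 ?ler01 // ltW // (lt_trans ltr01).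
rewrite -(@ltr_pXn2r _ 2) ?nnegrE ?mulr_ge0 ?normr_ge0 ?ler0c //.
rewrite exprMn -!add_Re2_Im2 -rmorphXn -rmorphM ltcR.
move: wz; rewrite -(@ltr_pXn2r _ 2) ?nnegrE ?normr_ge0 // -!add_Re2_Im2 ltcR.
case: z w => [a b] [c d] /=; rewrite !mul0r subr0 addr0 => wz.
rewrite -subr_gt0.
have -> : (r * a - c) ^+ 2 + (r * b - d) ^+ 2
    - ((r + 1) / 2) ^+ 2 * ((a - c) ^+ 2 + (b - d) ^+ 2)
  = (r - 1) / 4 * (2 * (r + 1) * ((a ^+ 2 + b ^+ 2) - (c ^+ 2 + d ^+ 2))
     + (r - 1) * ((a + c) ^+ 2 + (b + d) ^+ 2)) by field.
have r10 : 0 < r - 1 by rewrite subr_gt0.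
have zw0 : 0 < a ^+ 2 + b ^+ 2 - (c ^+ 2 + d ^+ 2) by rewrite subr_gt0.
have rp : 0 < r + 1 by lra.
have pq : 0 <= (r - 1) * ((a + c) ^+ 2 + (b + d) ^+ 2).
  by rewrite mulr_ge0 ?(ltW r10) // addr_ge0 ?sqr_ge0.
by rewrite mulr_gt0 ?divr_gt0 // ltr_wpDr // mulr_gt0 // mulr_gt0.
Qed.

Lemma horner_dilate (R : realType) (r : R) (P : {poly R[i]}) (z : R[i]) :
  (dilate r P).[z] = P.[r%:C * z].
Proof. by rewrite /dilate horner_comp !hornerE. Qed.

Lemma dilateD (R : realType) (r : R) (a : R[i]) (P Q : {poly R[i]}) :
  dilate r (a *: P + Q) = a *: dilate r P + dilate r Q.
Proof. by rewrite /dilate comp_polyD comp_polyZ. Qed.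

Lemma coef_dilate (R : realType) (r : R) (P : {poly R[i]}) (j : nat) :
  (dilate r P)`_j = (r ^+ j)%:C * P`_j.
Proof.
elim/poly_ind: P j => [|P c IH] j; first by rewrite /dilate comp_poly0 !coef0 mulr0.
rewrite /dilate comp_poly_MXaddC -/(dilate r P) -scalerAr !coefD coefZ !coefMX !coefC.
case: j => [|j] /=; first by rewrite mulr0 !add0r expr0 mul1r.
by rewrite IH !addr0 exprS rmorphM mulrA.
Qed.

Lemma dilateXn (R : realType) (r : R) (n : nat) :
  dilate r 'X^n = (r ^+ n)%:C *: 'X^n :> {poly R[i]}.
Proof. by rewrite /dilate comp_Xn_poly exprZn -rmorphXn. Qed.

Lemma dilate_growth (R : realType) (n : nat) (r : R) (F : {poly R[i]}) (z : R[i]) :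
  (1 <= n)%N -> 1 < r -> size F = n.+1 ->
  (forall w, 1 <= `|w| -> F.[w] != 0) -> 1 <= `|z| ->
  (((r + 1) / 2) ^+ n)%:C * `|F.[z]| < `|(dilate r F).[z]|.
Proof.
move=> n1 r1 sF zF z1; have [a [ws [a0 sws DF ws1]]] := poly_prod_roots _ _ _ sF zF.
rewrite horner_dilate DF !hornerZ !normrM mulrCA ltr_pM2l ?normr_gt0 //.
rewrite !horner_prod_XsubC !normr_prod.
have -> : (((r + 1) / 2) ^+ n)%:C = \prod_(w <- ws) ((r + 1) / 2)%:C.
  by rewrite big_const_seq count_predT sws iter_mulr_1 rmorphXn.
rewrite -big_split /= big_seq [ltRHS]big_seq; apply: ltr_prod.
  by case: ws sws n1 {DF ws1} => [<-|w ws _ _] //=; rewrite inE eqxx.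
move=> w wws; rewrite dilate_dist_lt ?(lt_le_trans (ws1 w wws)) //.
rewrite mulr_ge0 ?normr_ge0 // ler0c divr_ge0 ?ler0n // addr_ge0 ?ler01 //.
by rewrite ltW // (lt_trans ltr01).
Qed.

Lemma size_dilate (R : realType) (r : R) (P : {poly R[i]}) :
  r != 0 -> size (dilate r P) = size P.
Proof.
move=> r0; rewrite /dilate size_comp_poly2 // size_scale ?size_polyX //.
by rewrite -(rmorph0 (real_complex R)) (inj_eq (@complexI R)).
Qed.

Lemma multiplier_le (C : numDomainType) (a b q : C) :
  `|a| <= 1 -> `|b| <= 1 -> 1 <= q -> `|b * (q - `|a|) - a| <= q.
Proof.
move=> a1 b1 q1; have qa : 0 <= q - `|a| by rewrite subr_ge0 (le_trans a1).
apply: le_trans (ler_normB _ _) _.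
rewrite normrM (ger0_norm qa) -lerBrDr.
by rewrite ler_piMl.
Qed.

Definition dilate_comb (R : realType) (n : nat) (a b : R[i]) (r : R)
    (P : {poly R[i]}) : {poly R[i]} :=
  (b * ((((r + 1) / 2) ^+ n)%:C - `|a|) - a) *: P + dilate r P.

(** Since q = ((r+1)/2)^n is at least 1 >= |a|, the multiplier of F has modulus at
    most |a| + (q - |a|) = q, so by [dilate_growth] the dilated polynomial dominates
    outside the open disc; the same comparison, with r^n in place of the dilation,
    keeps the leading coefficient from vanishing. *)
Lemma dilate_comb_zeros (R : realType) (n : nat) (r : R) (a b : R[i]) (F : {poly R[i]}) :
  (1 <= n)%N -> 1 < r -> `|a| <= 1 -> `|b| <= 1 -> size F = n.+1 ->
  (forall w, 1 <= `|w| -> F.[w] != 0) ->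
  size (dilate_comb R n a b r F) = n.+1
  /\ forall w, 1 <= `|w| -> (dilate_comb R n a b r F).[w] != 0.
Proof.
move=> n1 r1 a1 b1 sF zF; rewrite /dilate_comb.
set q := (_ ^+ n)%:C; set k := _ - a; set G := _ + _.
have kq : `|k| <= q.
  apply: multiplier_le => //; rewrite /q -(rmorph1 (real_complex R)) lecR exprn_ege1 //.
  by rewrite ler_pdivlMr // mul1r lerD2r ltW.
split; last first.
  move=> w w1; rewrite hornerD hornerZ addrC.
  have := dilate_growth _ _ _ _ _ n1 r1 sF zF w1; rewrite -/q => lt.
  rewrite addr_eq0; apply: contraTneq lt => ->.
  rewrite normrN normrM -real_leNgt ?realM ?ger0_real ?normr_ge0 //.
    by rewrite ler_pM2r // normr_gt0 zF.
  exact: le_trans (normr_ge0 k) kq.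
have r0 : 0 < r by apply: lt_trans r1.
have sdF : size (dilate r F) = n.+1 by rewrite size_dilate ?sF ?gt_eqF.
apply/eqP; rewrite eqn_leq; apply/andP; split.
  rewrite (leq_trans (size_polyD _ _)) // geq_max sdF leqnn andbT.
  by rewrite (leq_trans (size_scale_leq _ _)) // sF.
have lF : F`_n != 0.
  by rewrite -[n]/(n.+1.-1) -sF -lead_coefE lead_coef_eq0 -size_poly_eq0 sF.
rewrite ltnNge; apply/negP => /leq_sizeP /(_ n (leqnn n)); apply/eqP.
have -> : G`_n = (k + (r ^+ n)%:C) * F`_n.
  by rewrite [LHS]coefD coefZ coef_dilate [RHS]mulrDl.
rewrite mulf_neq0 // addr_eq0.
have : q < (r ^+ n)%:C.
  rewrite ltcR ltrXn2r ?(gtn_eqF n1) //; first by lra.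
  by lra.
apply: contraTneq => kr; rewrite le_gtF //.
by rewrite -[(r ^+ n)%:C]ger0_norm ?ler0c ?exprn_ge0 ?(ltW r0) // -normrN -kr.
Qed.

(** * The inequality *)

Lemma horner_Bop_comb (R : realType) (n : nat) (l0 l1 l2 a b : R[i]) (r : R)
    (P : {poly R[i]}) (z : R[i]) :
  (Bop n l0 l1 l2 (dilate_comb R n a b r P)).[z] =
  (Bop n l0 l1 l2 (dilate r P)).[z] - a * (Bop n l0 l1 l2 P).[z]
    + b * ((((r + 1) / 2) ^+ n)%:C - `|a|) * (Bop n l0 l1 l2 P).[z].
Proof. by rewrite /dilate_comb horner_Bop_scalar; ring. Qed.

Lemma horner_BopZ (R : realType) (n : nat) (l0 l1 l2 c : R[i])
    (P : {poly R[i]}) (z : R[i]) :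
  (Bop n l0 l1 l2 (c *: P)).[z] = c * (Bop n l0 l1 l2 P).[z].
Proof. by rewrite !horner_Bop derivnZ derivZ !hornerZ; ring. Qed.

Lemma dilate_combXn (R : realType) (n : nat) (a b : R[i]) (r : R) :
  dilate_comb R n a b r 'X^n =
  (((r ^+ n)%:C - a) + b * ((((r + 1) / 2) ^+ n)%:C - `|a|)) *: 'X^n.
Proof. by rewrite /dilate_comb dilateXn -scalerDl; congr (_ *: _); ring. Qed.

(** For r > 1 the comparison is made for the whole functional, for r = 1 only for
    F |-> B[F](z): the combination is then a multiple of F, possibly zero. *)
Lemma Bop_comb_le (R : realType) (n : nat) (l0 l1 l2 a b : R[i]) (r : R)
    (P : {poly R[i]}) (M z : R[i]) :
  (1 <= n)%N ->
  (forall x, root (upoly n l0 l1 l2) x -> `|x| <= `|x - n%:R / 2|) ->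
  `|a| <= 1 -> `|b| <= 1 -> 1 <= r -> 1 <= `|z| -> (size P <= n.+1)%N ->
  (forall w : R[i], `|w| = 1 -> `|P.[w]| <= M) ->
  `|(Bop n l0 l1 l2 (dilate_comb R n a b r P)).[z]| <=
  `|(Bop n l0 l1 l2 (dilate_comb R n a b r 'X^n)).[z]| * M.
Proof.
move=> n1 zu a1 b1 r1 z1 sP PM.
have [/eqP r_eq1|r_neq1] := boolP (r == 1).
  have dc (F : {poly R[i]}) :
      dilate_comb R n a b r F = (b * (1 - `|a|) - a + 1) *: F.
    rewrite /dilate_comb r_eq1 -[1 + 1]/(2%:R) divff ?pnatr_eq0 // expr1n.
    rewrite [RHS]scalerDl scale1r; congr (_ + _); apply/polyP => j.
    by rewrite coef_dilate expr1n mul1r.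
  rewrite !dc !horner_BopZ !normrM -mulrA ler_wpM2l ?normr_ge0 //.
  apply: (comparison_principle _ _ _ (horner_Bop_scalar R n l0 l1 l2 z) _ _ _ sP PM).
  by move=> F sF zF; exact: Bop_neq0.
have r_gt1 : 1 < r by rewrite lt_neqAle eq_sym r_neq1.
pose L F := (Bop n l0 l1 l2 (dilate_comb R n a b r F)).[z].
have linL : scalar L.
  move=> c F G; rewrite /L /dilate_comb dilateD.
  by rewrite !horner_Bop_scalar; ring.
apply: (comparison_principle _ _ L linL _ _ _ sP PM) => F sF zF.
have [sG zG] := dilate_comb_zeros _ _ _ _ _ _ n1 r_gt1 a1 b1 sF zF.
exact: Bop_neq0.
Qed.

Lemma maxmod_monomial (R : realType) (n : nat) (lam : R[i]) :
  (maxmod (lam *: 'X^n))%:C = `|lam|.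
Proof.
have [w w1 <-] := maxmod_attained (lam *: 'X^n).
by rewrite hornerZ hornerXn normrM normrX w1 expr1n mulr1.
Qed.

Theorem theorem1 (R : realType) (n : nat) (n_ge1 : (1 <= n)%N)
    (l0 l1 l2 : R[i])
    (zeros_u : forall x : R[i], root (upoly n l0 l1 l2) x ->
       `|x| <= `|x - n%:R / 2|) :
  (forall (P : {poly R[i]}), size P = n.+1 ->
   forall (a b : R[i]) (r : R) (z : R[i]),
     `|a| <= 1 -> `|b| <= 1 -> 1 <= r -> 1 <= `|z| ->
     `|(Bop n l0 l1 l2 (dilate r P)).[z] - a * (Bop n l0 l1 l2 P).[z]
       + b * ((((r + 1) / 2) ^+ n)%:C - `|a|) * (Bop n l0 l1 l2 P).[z]|
     <= `|((r ^+ n)%:C - a) + b * ((((r + 1) / 2) ^+ n)%:C - `|a|)|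
        * `|(Bop n l0 l1 l2 'X^n).[z]| * (maxmod P)%:C)
  /\
  (forall (lam : R[i]), lam != 0 ->
   forall (a b : R[i]) (r : R) (z : R[i]),
     `|a| <= 1 -> `|b| <= 1 -> 1 <= r -> 1 <= `|z| ->
     `|(Bop n l0 l1 l2 (dilate r (lam *: 'X^n))).[z]
       - a * (Bop n l0 l1 l2 (lam *: 'X^n)).[z]
       + b * ((((r + 1) / 2) ^+ n)%:C - `|a|)
         * (Bop n l0 l1 l2 (lam *: 'X^n)).[z]|
     = `|((r ^+ n)%:C - a) + b * ((((r + 1) / 2) ^+ n)%:C - `|a|)|
       * `|(Bop n l0 l1 l2 'X^n).[z]| * (maxmod (lam *: 'X^n))%:C).

Proof.
split=> [P sP|lam _] a b r z a1 b1 r1 z1; rewrite -horner_Bop_comb.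
  rewrite -normrM -horner_BopZ -dilate_combXn.
  by apply: Bop_comb_le => //; [rewrite sP | exact: le_maxmod].
have -> : dilate_comb R n a b r (lam *: 'X^n) = lam *: dilate_comb R n a b r 'X^n.
  by rewrite /dilate_comb /dilate comp_polyZ scalerDr !scalerA mulrC.
by rewrite maxmod_monomial dilate_combXn !horner_BopZ !normrM mulrC.
Qed.
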